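(* Let $m$ be a positive integer. If there exist integers $k\geq 1$ and $i\geq 1$ such that $m=k\cdot 3^i+a_i$, then $m$ appears in the sequence $(B(n))_{n\geq1}$ exactly twice. Otherwise, $m$ appears in the sequence exactly once. Furthermore, the sequence $(B(n))_{n\geq 1}$ is monotone (weakly) increasing.
   Context: The sequence $(B(n))_{n\geq1}$ of positive integers is defined by the initial conditions $B(1)=1$, $B(2)=2$, $B(3)=3$, $B(4)=4$, $B(5)=5$ and, for $n\geq 6$, the nested recurrence $$B(n)=B(n-B(n-1))+B(n-B(n-2))+B(n-B(n-3)).$$ A priori, $B(n)$ is defined only if the three arguments on the right are all indices in $\{1,\dots,n-1\}$ at which $B$ is defined; an assertion about the whole sequence includes that $B(n)$ is defined for all $n\ge 1$. The auxiliary sequence $(a_i)_{i\geq 1}$ is defined by $a_1=3$ and $a_i=3a_{i-1}-1$ for $i\geq 2$; equivalently $a_i=\frac{5}{2}\cdot 3^{i-1}+\frac12$. *)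

(* Defs.v *)
From mathcomp Require Import all_boot.

Set Implicit Arguments.
Unset Strict Implicit.
Unset Printing Implicit Defensive.

(* [B_eq n v] reads "B(n) is defined and B(n) = v". The nested recurrence only
   defines a partial function a priori, so it is given by its graph; the range
   conditions also ensure that the truncated subtractions are genuine ones. *)
Inductive B_eq : nat -> nat -> Prop :=
| B_init n : 1 <= n <= 5 -> B_eq n n
| B_rec n b1 b2 b3 c1 c2 c3 :
    6 <= n ->
    B_eq (n - 1) b1 -> B_eq (n - 2) b2 -> B_eq (n - 3) b3 ->
    1 <= n - b1 <= n - 1 -> 1 <= n - b2 <= n - 1 -> 1 <= n - b3 <= n - 1 ->
    B_eq (n - b1) c1 -> B_eq (n - b2) c2 -> B_eq (n - b3) c3 ->
    B_eq n (c1 + c2 + c3).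

Lemma B_eq_fun n v w : B_eq n v -> B_eq n w -> v = w.
Proof.
move=> Hv; elim: Hv w => {n v}.
  move=> n /andP[_ n5] w Hw; case: Hw n5 => //.
  by move=> k b1 b2 b3 c1 c2 c3 k6 _ _ _ _ _ _ _ _ _ /(leq_trans k6).
move=> n b1 b2 b3 c1 c2 c3 n6 _ I1 _ I2 _ I3 _ _ _ _ J1 _ J2 _ J3 w Hw.
case: Hw n6 I1 I2 I3 J1 J2 J3 => {n w}.
  by move=> n /andP[_ n5] n6; have := leq_trans n6 n5.
move=> n d1 d2 d3 e1 e2 e3 _ D1 D2 D3 _ _ _ E1 E2 E3 _ I1 I2 I3.
rewrite (I1 _ D1) (I2 _ D2) (I3 _ D3) => J1 J2 J3.
by rewrite (J1 _ E1) (J2 _ E2) (J3 _ E3).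
Qed.

Lemma B_eq_gt0 n v : B_eq n v -> 0 < n /\ 0 < v.
Proof.
elim=> {n v} [n /andP[n1 _] //|].
move=> n b1 b2 b3 c1 c2 c3 n6 _ _ _ _ _ _ _ _ _ _ [_ c1p] _ _ _ _.
by split; [exact: leq_trans n6 | rewrite -addnA ltn_addr].
Qed.

(* Since [B_eq n m] forces n >= 1, this counts indices n >= 1. *)
Definition appears_exactly (r m : nat) : Prop :=
  exists s : seq nat,
    [/\ uniq s, size s = r & forall n, n \in s <-> B_eq n m].

(* The sequence is indexed from 1; [a 0] is a dummy value. *)
Fixpoint a (i : nat) : nat :=
  match i with
  | 0 => 0
  | 1 => 3
  | i'.+1 => 3 * a i' - 1
  end.

(* Main.v *)
Require Import Defs.
From mathcomp Require Import all_boot.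
From mathcomp Require Import zify.

(** Call [m] repeated when [m = k * 3 ^ i + a i] for some [k, i >= 1], and let
    [last_index m] be [m] plus the number of repeated values up to [m]. The
    theorem says that the value [v] occupies exactly the block of indices
    [last_index v.-1 < n <= last_index v].

    Since [a 1 = 3] and [a i.+1 = 3 * a i - 1], being repeated is governed by
    the residue modulo 3: [3 * q] is repeated iff [2 <= q], [3 * q + 1] never
    is, and [3 * q + 2] is repeated iff [q + 1] is. Counting repeated values
    gives [last_index (3 * q + 1) = 3 * q + last_index q] for [q >= 1]
    ([last_index_3q1]).

    This self-similarity makes the blocks satisfy the nested recurrence
    ([block_B_eq], by strong induction on the index). For an index [n] in the
    block of [3 * q + r], the three preceding values are within 3 of [3 * q],
    so subtracting them from [n] leaves indices near [last_index q], which lie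
    in the blocks of [q - 1], [q] and [q + 1]; in each case the three values
    found there add up to [3 * q + r]. The blocks partition the positive
    integers, and [B_eq] is functional, so they describe the whole sequence. *)

(** * Repeated values *)

Lemma aSS i : a i.+2 = 3 * a i.+1 - 1.
Proof. by []. Qed.

Lemma a_gt2 i : 1 <= i -> 3 <= a i.
Proof.
case: i => // i _; elim: i => // i IHi.
by rewrite aSS; lia.
Qed.

(** A boolean form of the existence of [k, i >= 1] with [m = k * 3 ^ i + a i];
    the exponent is bounded because [i < 3 ^ i <= m]. *)
Definition repeated (m : nat) : bool :=
  [exists i : 'I_m.+1,
     [&& 1 <= i, a i + 3 ^ i <= m & 3 ^ i %| m - a i]].

Lemma repeatedP m :
  reflect (exists k i : nat, [/\ 1 <= k, 1 <= i & m = k * 3 ^ i + a i])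
          (repeated m).
Proof.
apply: (iffP existsP) => [[i /and3P[i1 le_m /dvdnP[k def_k]]]|[k [i [k1 i1 ->]]]].
  exists k, i; split=> //; last by lia.
  by case: k def_k => // def_k; have := expn_gt0 3 i; lia.
have lt_i : i < 3 ^ i by exact: ltn_expl.
have le_k : 3 ^ i <= k * 3 ^ i by rewrite leq_pmull.
have lt_im : i < (k * 3 ^ i + a i).+1 by lia.
exists (Ordinal lt_im) => /=; apply/and3P; split=> //; first by lia.
by rewrite addnK dvdn_mull.
Qed.

Lemma repeated_3q q : repeated (3 * q) = (2 <= q).
Proof.
apply/repeatedP/idP => [[k [i [k1 i1 def_q]]]|q2]; last first.
  by exists q.-1, 1; split=> //; rewrite ?expn1 /=; lia.
by have := a_gt2 i i1; have := expn_gt0 3 i; nia.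
Qed.

Lemma repeated_3q1 q : repeated (3 * q + 1) = false.
Proof.
apply/repeatedP => -[k [i [k1 i1]]].
case: i i1 => [|[|i]] // _; first by rewrite expn1 /=; lia.
(* for [2 <= i] the value is 2 modulo 3 *)
rewrite aSS expnS mulnCA; have := a_gt2 i.+1 isT.
by move: (k * _) (a _) => x y; lia.
Qed.

Lemma repeated_3q2 q : repeated (3 * q + 2) = repeated q.+1.
Proof.
apply/repeatedP/repeatedP => -[k [i [k1 i1 def_q]]].
  case: i i1 def_q => [|[|i]] // _; first by rewrite expn1 /=; lia.
  rewrite aSS expnS mulnCA => def_q; exists k, i.+1; split=> //.
  by have := a_gt2 i.+1 isT; move: (k * _) (a _) def_q => x y; lia.
case: i i1 def_q => // i _ def_q; exists k, i.+2; split=> //.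
rewrite aSS expnS mulnCA; have := a_gt2 i.+1 isT.
by move: (k * _) (a _) def_q => x y; lia.
Qed.

(** * The last index of each value *)

(** The last index carrying the value [m]: each value up to [m] is counted
    once, and the repeated ones once more. *)
Fixpoint last_index (m : nat) : nat :=
  if m is m'.+1 then last_index m' + 1 + repeated m else 0.

Lemma last_indexS m :
  last_index m.+1 = last_index m + 1 + repeated m.+1.
Proof. by []. Qed.

Lemma leq_last_index m : m <= last_index m.
Proof. by elim: m => // m IHm; rewrite last_indexS; lia. Qed.

Lemma last_index_mono : {homo last_index : m n / m <= n}.
Proof.
apply: homo_leq leqnn leq_trans _ => m.
by rewrite last_indexS -addnA leq_addr.
Qed.

Lemma repeated_small m : 1 <= m <= 5 -> repeated m = false.
Proof.
have r1 : repeated 1 = false := repeated_3q1 0.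
have r2 : repeated 2 = false by rewrite (repeated_3q2 0).
case: m => [|[|[|[|[|[|]]]]]] // _; last by rewrite (repeated_3q2 1).
  exact: (repeated_3q 1).
exact: (repeated_3q1 1).
Qed.

Lemma last_index_small m : m <= 5 -> last_index m = m.
Proof.
elim: m => // m IHm m5.
by rewrite last_indexS IHm ?repeated_small ?addn0 ?addn1 // ltnW.
Qed.

Lemma last_index_3q2 q :
  last_index (3 * q + 2) = last_index (3 * q + 1) + 1 + repeated q.+1.
Proof. by rewrite [3 * q + 2]addnS last_indexS -addnS repeated_3q2. Qed.

Lemma last_index_3q3 q : 1 <= q ->
  last_index (3 * q + 3) = last_index (3 * q + 2) + 2.
Proof.
move=> q1; rewrite [3 * q + 3]addnS last_indexS -addnS -mulnSr repeated_3q.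
by lia.
Qed.

Lemma last_index_3q4 q :
  last_index (3 * q + 4) = last_index (3 * q + 3) + 1.
Proof.
rewrite [3 * q + 4]addnS last_indexS.
have -> : (3 * q + 3).+1 = 3 * q.+1 + 1 by lia.
by rewrite repeated_3q1 addn0.
Qed.

(** The self-similarity of the block structure. *)
Lemma last_index_3q1 q : 1 <= q ->
  last_index (3 * q + 1) = 3 * q + last_index q.
Proof.
case: q => // q _; elim: q => [|q IHq]; first by rewrite !last_index_small.
have -> : 3 * q.+2 + 1 = 3 * q.+1 + 4 by lia.
by rewrite last_index_3q4 last_index_3q3 // last_index_3q2 IHq
   (last_indexS q.+1); lia.
Qed.

(** * The blocks satisfy the nested recurrence *)

(** The index [n] lies in the block of the value [v]. *)
Definition in_block (n v : nat) : Prop :=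
  1 <= v /\ last_index v.-1 < n <= last_index v.

(** One step of the recurrence, under the induction hypothesis that blocks are
    right below [n]. The range conditions of [B_rec] come for free: every index
    and every value of a block is positive. *)
Lemma B_eq_step n v v1 v2 v3 c1 c2 c3 :
  (forall k, k < n -> forall w, in_block k w -> B_eq k w) -> 6 <= n ->
  in_block (n - 1) v1 -> in_block (n - 2) v2 -> in_block (n - 3) v3 ->
  in_block (n - v1) c1 -> in_block (n - v2) c2 -> in_block (n - v3) c3 ->
  c1 + c2 + c3 = v -> B_eq n v.
Proof.
move=> IHn n6 b1 b2 b3 d1 d2 d3 <-.
have range w c : in_block (n - w) c -> 1 <= w -> 1 <= n - w <= n - 1.
  by case=> _; lia.
have B_sub w c : in_block (n - w) c -> 1 <= w -> B_eq (n - w) c.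
  by move=> dw w1; apply: IHn => //; lia.
have [[w1 _] [w2 _] [w3 _]] := And3 b1 b2 b3.
apply: (@B_rec n v1 v2 v3) => //; try exact: B_sub.
- exact: range d1 w1.
- exact: range d2 w2.
- exact: range d3 w3.
Qed.

Lemma in_blockS n m :
  last_index m < n <= last_index m.+1 -> in_block n m.+1.
Proof. by []. Qed.

Lemma in_block_addS n m i :
  last_index (m + i) < n <= last_index (m + i.+1) -> in_block n (m + i.+1).
Proof. by rewrite addnS. Qed.

(** Closes a membership in a block, or an equality between sums of values, by
    linear arithmetic on the known values of [last_index]. *)
Ltac solve_block :=
  first [apply: in_block_addS; lia | apply: in_blockS; lia | lia].

(** The case analysis is on [v] modulo 3, then on whether [q] (for [v = 3 * q])
    or [q + 1] (for [v = 3 * q + 2]) is repeated, and on the position of [n] in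
    its block. *)
Lemma block_B_eq n v : in_block n v -> B_eq n v.
Proof.
elim/ltn_ind: n v => n IHn v [v1 bv].
have [v5|v6] := leqP v 5.
  have -> : n = v by move: bv; rewrite !last_index_small; lia.
  by apply: B_init; rewrite v1.
have n6 : 6 <= n.
  by have := @last_index_mono 5 v.-1; rewrite last_index_small //; lia.
(* [v = 3 * q + r] with [q = s.+2]; the arguments of the recurrence fall in the
   blocks of [s.+1], [s.+2] and [s.+3]. *)
have [s cases_v] : exists s,
    (v.-1 = 3 * s + 5 /\ v = 3 * s + 6) \/
    (v.-1 = 3 * s + 6 /\ v = 3 * s + 7) \/
    (v.-1 = 3 * s + 7 /\ v = 3 * s + 8).
  by exists (v %/ 3 - 2); lia.
(* The values of [last_index] near [3 * s.+2], rewritten as [3 * s + i] with a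
   numeral [i], so that the uses of one value are syntactically equal. *)
have f1 := last_indexS s; have f2 := last_indexS s.+1.
have f3 := last_indexS s.+2.
have v3 : last_index (3 * s + 2) < last_index (3 * s + 3).
  by rewrite [3 * s + 3]addnS last_indexS; lia.
have v4 := last_index_3q4 s.
have v4' := @last_index_3q1 s.+1 isT; have v5 := last_index_3q2 s.+1.
have v6' := @last_index_3q3 s.+1 isT; have v7 := last_index_3q4 s.+1.
have v8 := last_index_3q2 s.+2; rewrite {v1}.
have e1 i : 3 * s.+1 + i = 3 * s + (3 + i) by lia.
have e2 i : 3 * s.+2 + i = 3 * s + (6 + i) by lia.
rewrite !(e1, e2) {e1 e2} /= in v4' v5 v6' v7 v8.
rewrite -[3 + 1]/4 -[3 + 2]/5 -[3 + 3]/6 -[3 + 4]/7 -[6 + 1]/7 -[6 + 2]/8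
  in v4' v5 v6' v7 v8.
have step w1 w2 w3 c1 c2 c3 := @B_eq_step n v w1 w2 w3 c1 c2 c3 IHn n6.
case: cases_v => [[pred_v def_v]|[[pred_v def_v]|[pred_v def_v]]];
  rewrite pred_v def_v in bv.
- case: (boolP (repeated s.+2)) f2 v5 => r2 f2 v5.
    (* the block of [3 * q] has two indices, its last and its first *)
    have [e|e] : n = last_index (3 * s + 6) \/ n = (last_index (3 * s + 5)).+1
      by lia.
    + by apply: (step (3 * s + 6) (3 * s + 5) (3 * s + 5) s.+2 s.+2 s.+2);
        solve_block.
    + by apply: (step (3 * s + 5) (3 * s + 5) (3 * s + 4) s.+2 s.+2 s.+2);
        solve_block.
  have [e|e] : n = last_index (3 * s + 6) \/ n = (last_index (3 * s + 5)).+1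
    by lia.
  + by apply: (step (3 * s + 6) (3 * s + 5) (3 * s + 4) s.+1 s.+2 s.+3);
      solve_block.
  + by apply: (step (3 * s + 5) (3 * s + 4) (3 * s + 3) s.+1 s.+2 s.+3);
      solve_block.
- by apply: (step (3 * s + 6) (3 * s + 6) (3 * s + 5) s.+2 s.+2 s.+3);
    solve_block.
- case: (boolP (repeated s.+3)) f3 v8 => r2 f3 v8; last first.
    by apply: (step (3 * s + 7) (3 * s + 6) (3 * s + 6) s.+2 s.+3 s.+3);
      solve_block.
  have [e|e] : n = last_index (3 * s + 8) \/ n = (last_index (3 * s + 7)).+1
    by lia.
  + by apply: (step (3 * s + 8) (3 * s + 7) (3 * s + 6) s.+2 s.+3 s.+3);
      solve_block.
  + by apply: (step (3 * s + 7) (3 * s + 6) (3 * s + 6) s.+2 s.+3 s.+3);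
      solve_block.
Qed.

(** * The blocks describe the sequence *)

Lemma in_block_exists n : 1 <= n -> exists v, in_block n v.
Proof.
move=> n1; have ex_v : exists v, n <= last_index v.
  by exists n; exact: leq_last_index.
case: (ex_minnP ex_v) => -[|v] le_nv min_v; first by move: le_nv => /=; lia.
exists v.+1; split=> //; rewrite le_nv andbT ltnNge.
by apply/negP => /min_v; rewrite ltnn.
Qed.

Lemma B_eqP n v : B_eq n v <-> in_block n v.
Proof.
split=> [Bnv|]; last exact: block_B_eq.
have [n1 _] := B_eq_gt0 Bnv.
have [w bw] := in_block_exists n n1.
by rewrite (B_eq_fun Bnv (block_B_eq _ _ bw)).
Qed.

Lemma appears_repeated m : 1 <= m -> appears_exactly (1 + repeated m) m.
Proof.
case: m => // m _.
exists (iota (last_index m).+1 (1 + repeated m.+1)).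
split; [exact: iota_uniq | exact: size_iota |] => n.
rewrite mem_iota addSn addnA ltnS -last_indexS; split.
  by move=> ?; apply/B_eqP.
by case/B_eqP.
Qed.

Theorem theorem2 :
  (forall n : nat, 1 <= n -> exists v : nat, B_eq n v)
  /\ (forall m : nat, 1 <= m ->
        ((exists k i : nat, [/\ 1 <= k, 1 <= i & m = k * 3 ^ i + a i]) ->
           appears_exactly 2 m)
        /\ (~ (exists k i : nat, [/\ 1 <= k, 1 <= i & m = k * 3 ^ i + a i]) ->
           appears_exactly 1 m))
  /\ (forall n1 n2 v1 v2 : nat,
        n1 <= n2 -> B_eq n1 v1 -> B_eq n2 v2 -> v1 <= v2).
Proof.
split; [|split].
- by move=> n /in_block_exists[v /B_eqP ?]; exists v.
- move=> m m1; have := appears_repeated m m1.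
  by case: repeatedP.
- move=> n1 n2 v1 v2 le_n /B_eqP[_ /andP[lt1 _]] /B_eqP[_ /andP[_ le2]].
  rewrite leqNgt; apply/negP => lt_v.
  have : last_index v2 <= last_index v1.-1 by apply: last_index_mono; lia.
  lia.
Qed.
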